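(* Let $X$ be a compact metric space, let $F:X\to 2^X$ be upper semi-continuous, and let $k\in\mathbb{N}$. Then $$h(F)\le h(F^k)\le k\,h(F).$$
   Context: $\mathbb{N}=\{1,2,\ldots\}$. For a compact metric space $X$ with metric $d$, $2^X$ is the set of non-empty compact subsets of $X$. $F:X\to 2^X$ is upper semi-continuous if for every $x\in X$ and every open $V\subseteq X$ containing $F(x)$ there is an open $U\ni x$ with $F(t)\subseteq V$ for all $t\in U$. Iterates: $F^0$ is the identity and $F^n=F\circ F^{n-1}$, where $(G\circ F)(x)=\bigcup_{y\in F(x)}G(y)$; each $F^n$ with $n\ge1$ is again an upper semi-continuous function $X\to2^X$. Entropy: for $n\in\mathbb{N}$, $\mathrm{Orb}_n(X,F)$ is the set of $n$-orbits, i.e. finite sequences $(x_0,\ldots,x_{n-1})$ in $X$ with $x_{i+1}\in F(x_i)$ for $0\le i\le n-2$, with the metric $D(\mathbf{x},\mathbf{y})=\max_{0\le i\le n-1}d(x_i,y_i)$. A subset of a metric space is $\epsilon$-separated if any two of its distinct points are at distance $\ge\epsilon$. $s_{n,\epsilon}(F)$ is the largest cardinality of an $\epsilon$-separated subset of $(\mathrm{Orb}_n(X,F),D)$, and the topological entropy of $F$ is $h(F)=\lim_{\epsilon\to0}\limsup_{n\to\infty}\frac1n\log s_{n,\epsilon}(F)\in[0,\infty]$ (with $k\cdot\infty=\infty$). The entropy $h(F^k)$ is defined in the same way with $F^k$ in place of $F$. *)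

(* Defs.v *)
From HB Require Import structures.
From mathcomp Require Import all_boot all_order all_algebra.
From mathcomp Require Import all_classical all_reals all_analysis.

Set Implicit Arguments.
Unset Strict Implicit.
Unset Printing Implicit Defensive.

Import Order.TTheory GRing.Theory Num.Theory.
Import numFieldNormedType.Exports.

Local Open Scope classical_set_scope.
Local Open Scope ring_scope.

(* A function X -> 2^X is a set-valued map F : X -> set X satisfying
   [compact_valued F]. *)
Definition compact_valued (X : topologicalType) (F : X -> set X) : Prop :=
  forall x, F x !=set0 /\ compact (F x).

Definition upper_semicontinuous (X : topologicalType) (F : X -> set X) : Prop :=
  forall (x : X) (V : set X), open V -> F x `<=` V ->
    exists U : set X, [/\ open U, U x & forall t, U t -> F t `<=` V].

Definition set_comp (X : Type) (G F : X -> set X) : X -> set X :=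
  fun x => \bigcup_(y in F x) G y.

Fixpoint set_iter (X : Type) (n : nat) (F : X -> set X) : X -> set X :=
  if n is n'.+1 then set_comp F (set_iter n' F) else fun x => [set x].

Definition Orb (X : Type) (n : nat) (F : X -> set X) : set (n.-tuple X) :=
  [set x | forall i j : 'I_n, j = i.+1 :> nat -> F (tnth x i) (tnth x j)].
Arguments Orb [X] n F.

Definition orb_dist (R : realType) (X : metricType R) (n : nat)
    (x y : n.-tuple X) : R :=
  \big[Num.max/0]_(i < n) mdist (tnth x i) (tnth y i).

Definition eps_separated (R : realType) (T : Type) (dist : T -> T -> R)
    (e : R) (A : set T) : Prop :=
  forall x y, A x -> A y -> x <> y -> e <= dist x y.

(* The supremum is taken over the cardinalities of the finite separated
   subsets. When X is compact it is attained, hence is the largest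
   cardinality of a separated subset. *)
Definition sep_number (R : realType) (X : metricType R) (F : X -> set X)
    (n : nat) (e : R) : \bar R :=
  ereal_sup [set (m%:R)%:E | m in
    [set m : nat | exists A : set (n.-tuple X),
      [/\ A `<=` Orb n F, eps_separated (@orb_dist R X n) e A
        & (A #= `I_m)%card]]].

(* The inner limsup is nonincreasing in e, so the limit at 0 from the right
   exists in \bar R. The term n = 0 does not affect the limsup. *)
Definition entropy (R : realType) (X : metricType R) (F : X -> set X)
    : \bar R :=
  lim (limn_esup (fun n : nat => ((n%:R)^-1)%:E * lne (sep_number F n e))%E
    @[e --> (0 : R)^'+]).

(* Main.v *)
Require Import Defs.
From HB Require Import structures.
From mathcomp Require Import all_boot all_order all_algebra.
From mathcomp Require Import all_classical all_reals all_analysis.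
From mathcomp Require Import lra.

Import Order.TTheory GRing.Theory Num.Theory.
Import numFieldNormedType.Exports.

Local Open Scope classical_set_scope.
Local Open Scope ring_scope.

(** Write [s(F, n, e)] for [sep_number F n e]. Both inequalities come from
    comparing [n]-orbits of [F^k] with [nk]-orbits of [F].

    An [n]-orbit of [F^k] is the trace of an [nk]-orbit of [F] on the times
    divisible by [k], and filling in the missing points keeps orbits separated.
    Hence [s(F^k, n, e) <= s(F, nk, e)], and dividing the logarithms by [n] gives
    [h(F^k) <= k h(F)].

    In the other direction, an [nk]-orbit of [F] is the interleaving of [k]
    orbits of [F^k] of length [n], one for each residue class of times. A maximal
    [e]-separated set of [n]-orbits of [F^k] comes within [e] of every such
    orbit, and two [nk]-orbits of [F] for which the same [k]-tuple of its members
    can be chosen are at distance less than [2e]. Therefore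
    [s(F, nk, 2e) <= s(F^k, n, e)^k] (see [separated_family_power] and
    [lne_sep_number_le_iter]). As [s(F, -, 2e)] is nondecreasing, its growth rate
    is governed by the multiples of [k] ([growth_rate_multiples]), so the rate
    for [F] at scale [2e] is at most the rate for [F^k] at scale [e]. Letting [e]
    tend to [0] gives [h(F) <= h(F^k)].

    Because [F] has nonempty values, every nonempty finite orbit is the beginning
    of an infinite one. Separated sets of [n]-orbits are accordingly replaced by
    families of infinite trajectories that are separated before time [n]
    ([sep_number_families]), so that changing the length of orbits amounts to
    changing a bound on times. *)

(** * Trajectories of a set-valued map and of its iterates *)

Definition trajectory {X : Type} (F : X -> set X) (g : nat -> X) : Prop :=
  forall t, F (g t) (g t.+1).

Definition nonempty_valued {X : Type} (F : X -> set X) : Prop :=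
  forall x, F x !=set0.

Lemma set_iter_path {X : Type} {F : X -> set X} {k : nat} {x y : X} :
  set_iter k F x y ->
  exists p : nat -> X,
    [/\ p 0%N = x, p k = y & forall i, (i < k)%N -> F (p i) (p i.+1)].
Proof.
elim: k y => [|k IH] y /=; first by move=> ->; exists (fun=> x).
move=> [z /IH[p [p0 pk pF]] Fzy].
exists (fun i => if (i <= k)%N then p i else y); split=> //; first by rewrite ltnn.
move=> i; rewrite ltnS => ik1; rewrite ik1; move: ik1.
rewrite leq_eqVlt => /predU1P[->|ik]; first by rewrite ltnn pk.
by rewrite ik; exact: pF.
Qed.

Lemma set_iter_trajectory {X : Type} {F : X -> set X} {g : nat -> X} (k t : nat) :
  trajectory F g -> set_iter k F (g t) (g (t + k)%N).
Proof.
move=> gF; elim: k => [|k IH] /=; first by rewrite addn0.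
by exists (g (t + k)%N) => //; rewrite addnS.
Qed.

Lemma set_iter_nonempty {X : Type} {F : X -> set X} (k : nat) :
  nonempty_valued F -> nonempty_valued (set_iter k F).
Proof.
move=> F0; elim: k => [|k IH] x /=; first by exists x.
have [y Fy] := IH x; have [z Fz] := F0 y.
by exists z; exists y.
Qed.

Lemma trajectory_subsample {X : Type} {F : X -> set X} {g : nat -> X} (k j : nat) :
  trajectory F g -> trajectory (set_iter k F) (fun t => g (t * k + j)%N).
Proof.
move=> gF t /=; rewrite mulSn -addnA [(k + _)%N]addnC.
exact: set_iter_trajectory.
Qed.

(** Each step of a trajectory of [F^k] is a path of [k] steps of [F];
    concatenating chosen paths fills in the intermediate points. *)
Lemma trajectory_refine {X : Type} {F : X -> set X} {k : nat} {h : nat -> X} :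
  (0 < k)%N -> trajectory (set_iter k F) h ->
  exists g, trajectory F g /\ forall t, g (t * k)%N = h t.
Proof.
move=> k0 hF.
have [p pP] := choice (fun t => set_iter_path (hF t)).
have p0 t : p t 0%N = h t by case: (pP t).
exists (fun s => p (s %/ k)%N (s %% k)%N); split; last first.
  by move=> t; rewrite mulnK// modnMl p0.
move=> s; have [_ _ pF] := pP (s %/ k)%N.
have sk := ltn_pmod s k0.
have [sk1|sk1] := ltnP (s %% k).+1 k.
  have sE : s.+1 = (s %/ k * k + (s %% k).+1)%N by rewrite addnS -divn_eq.
  have -> : (s.+1 %/ k = s %/ k)%N by rewrite {1}sE divnMDl// (divn_small sk1) addn0.
  have -> : (s.+1 %% k = (s %% k).+1)%N by rewrite {1}sE modnMDl modn_small.
  exact: pF.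
(* The last step of a block lands on the first point of the next block. *)
have kE : (s %% k).+1 = k by apply/eqP; rewrite eqn_leq sk sk1.
have sE : s.+1 = ((s %/ k).+1 * k)%N by rewrite mulSn addnC -{3}kE addnS -divn_eq.
rewrite sE mulnK// modnMl p0.
have [_ <- _] := pP (s %/ k)%N.
by have := pF _ sk; rewrite kE.
Qed.

Definition prefix_tuple {X : Type} (n : nat) (g : nat -> X) : n.-tuple X :=
  [tuple g i | i < n].

Lemma Orb_prefix_tuple {X : Type} {F : X -> set X} {g : nat -> X} (n : nat) :
  trajectory F g -> Orb n F (prefix_tuple n g).
Proof. by move=> gF i j ij; rewrite !tnth_mktuple ij. Qed.

(** The last entry, which exists because [0 < n], is the point from which the
    orbit is continued by a selection of [F]. *)
Lemma Orb_extend {X : Type} {F : X -> set X} {n : nat} {x : n.-tuple X} :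
  nonempty_valued F -> (0 < n)%N -> Orb n F x ->
  exists2 g, trajectory F g & prefix_tuple n g = x.
Proof.
move=> F0; case: n x => // n x _ xF.
have [s sP] := choice F0.
pose x0 := tnth x ord_max.
have x0E : nth x0 x n = x0 := esym (tnth_nth x0 x ord_max).
exists (fun t => if (t < n)%N then nth x0 x t else iter (t - n) s x0).
  move=> t; have [tn|nt] := ltnP t n; last first.
    by rewrite ltnNge (leqW nt)/= subSn//; exact: sP.
  have t1 : (t < n.+1)%N by exact: ltnW.
  have -> : (if (t.+1 < n)%N then nth x0 x t.+1 else iter (t.+1 - n) s x0) =
            tnth x (Ordinal (tn : (t.+1 < n.+1)%N)).
    rewrite (tnth_nth x0)/=; case: ltnP => // nt.
    have -> : t.+1 = n by apply/eqP; rewrite eqn_leq tn nt.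
    by rewrite subnn x0E.
  have -> : nth x0 x t = tnth x (Ordinal t1) by rewrite (tnth_nth x0).
  exact: xF.
apply: eq_from_tnth => i; rewrite tnth_mktuple (tnth_nth x0).
case: ltnP => // ni.
have -> : i = n :> nat by apply/eqP; rewrite eqn_leq ni -ltnS ltn_ord.
by rewrite subnn x0E.
Qed.

(** * Separated families of trajectories *)

Definition separated_family {R : realType} {X : metricType R} (F : X -> set X)
    (n : nat) (e : R) (m : nat) : Prop :=
  exists f : 'I_m -> nat -> X, (forall i, trajectory F (f i)) /\
    forall i j, i != j ->
      exists2 t, (t < n)%N & e <= mdist (f i t) (f j t).

Lemma orb_dist_prefix_geP {R : realType} {X : metricType R} {n : nat} {e : R}
    {g h : nat -> X} : 0 < e ->
  (e <= orb_dist (prefix_tuple n g) (prefix_tuple n h)) <->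
  exists2 t, (t < n)%N & e <= mdist (g t) (h t).
Proof.
move=> e0; split=> [egh|[t tn egh]].
  apply: contrapT => /forall2NP H.
  move: egh; rewrite leNgt => /negP; apply; apply/bigmax_ltP; split=> // i _.
  rewrite !tnth_mktuple ltNge; apply/negP => egh.
  by have [] := H i; [rewrite ltn_ord|].
apply: le_trans egh _.
have := @le_bigmax _ _ _ 0 (fun i : 'I_n => mdist (tnth (prefix_tuple n g) i)
  (tnth (prefix_tuple n h) i)) (Ordinal tn).
by rewrite !tnth_mktuple.
Qed.

(** Members of a separated set have distinct prefixes when [0 < e], so
    counting the set is the same as indexing it by ['I_m]. *)
Lemma sep_number_families {R : realType} {X : metricType R} {F : X -> set X}
    {n : nat} {e : R} : nonempty_valued F -> (0 < n)%N -> 0 < e ->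
  sep_number F n e = ereal_sup [set (m%:R)%:E | m in separated_family F n e].
Proof.
move=> F0 n0 e0; congr (ereal_sup (_ @` _)); apply/seteqP; split=> m /=.
  move=> [A [AF Asep /card_set_bijP[c [_ _ cS]]]].
  have fP (i : 'I_m) : exists g,
      [/\ trajectory F g, A (prefix_tuple n g) & c (prefix_tuple n g) = i].
    have [x Ax cx] := cS i (ltn_ord i).
    have [g gF gx] := Orb_extend F0 n0 (AF _ Ax).
    by exists g; rewrite gx.
  have [f fE] := choice fP.
  exists f; split=> [i|i j ij]; first by have [] := fE i.
  have [_ Ai ci] := fE i; have [_ Aj cj] := fE j.
  apply/(orb_dist_prefix_geP e0); apply: Asep => // fij.
  by move/eqP: ij; apply; apply/val_inj; rewrite /= -ci -cj fij.
move=> [f [fF fsep]].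
pose p i := prefix_tuple n (f i).
have psep i j : i != j -> e <= orb_dist (p i) (p j).
  by move=> /fsep H; apply/(orb_dist_prefix_geP e0).
have pinj : injective p.
  move=> i j pij; apply/eqP/negPn/negP => /fsep/(orb_dist_prefix_geP e0).
  rewrite -/(p i) -/(p j) pij => /(orb_dist_prefix_geP e0)[t _].
  by rewrite mdistxx leNgt e0.
exists (range p); split.
- by move=> _ [i _ <-]; exact: Orb_prefix_tuple.
- move=> _ _ [i _ <-] [j _ <-] ij; apply: psep.
  by apply/eqP => ij'; apply: ij; rewrite ij'.
- apply: (@card_eq_trans _ _ _ _ [set: 'I_m]).
    by apply: inj_card_eq => i j _ _; exact: pinj.
  apply/card_set_bijP; exists (@nat_of_ord m); split=> [i _|i j _ _|i im] /=.
  + exact: ltn_ord.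
  + exact: ord_inj.
  + by exists (Ordinal im).
Qed.

Lemma separated_family_mono {R : realType} {X : metricType R} {F : X -> set X}
    {n n' : nat} {e : R} {m : nat} : (n <= n')%N ->
  separated_family F n e m -> separated_family F n' e m.
Proof.
move=> nn' [f [fF fsep]]; exists f; split=> // i j /fsep[t tn et].
by exists t => //; exact: leq_trans nn'.
Qed.

Lemma separated_family_refine {R : realType} {X : metricType R} {F : X -> set X}
    {k n : nat} {e : R} {m : nat} : (0 < k)%N ->
  separated_family (set_iter k F) n e m -> separated_family F (n * k) e m.
Proof.
move=> k0 [f [fF fsep]].
have [g gP] := choice (fun i => trajectory_refine k0 (fF i)).
exists g; split=> [i|i j /fsep[t tn et]]; first by have [] := gP i.
have [_ gi] := gP i; have [_ gj] := gP j.
by exists (t * k)%N; rewrite ?ltn_mul2r ?k0// gi gj.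
Qed.

(** Residue classes of times modulo [k] cut a trajectory of [F] into [k]
    trajectories of [F^k], each of which is [e]-close to a member of a family of
    maximal size. The [k] members so obtained determine the trajectory up to
    [2e], whence the bound. *)
Lemma separated_family_power {R : realType} {X : metricType R} {F : X -> set X}
    {k n : nat} {e : R} {m p : nat} : (0 < k)%N ->
  separated_family (set_iter k F) n e m ->
  ~ separated_family (set_iter k F) n e m.+1 ->
  separated_family F (n * k) (e *+ 2) p -> (p <= m ^ k)%N.
Proof.
move=> k0 [f [fF fsep]] maxm [g [gF gsep]].
have near_f h : trajectory (set_iter k F) h ->
    exists i, forall t, (t < n)%N -> mdist (h t) (f i t) < e.
  move=> hF; apply: contrapT => /forallNP far; apply: maxm.
  have {}far i : exists2 t, (t < n)%N & e <= mdist (h t) (f i t).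
    apply: contrapT => /forall2NP H; apply: (far i) => t tn.
    by have [//|/negP] := H t; rewrite -ltNge.
  (* A trajectory far from every member would enlarge the maximal family. *)
  exists (fun i => if unlift ord0 i is Some j then f j else h); split=> [i|i j].
    by case: unliftP.
  case: unliftP => [i' ->|->]; case: unliftP => [j' ->|->]; rewrite ?eqxx//.
  - by rewrite (inj_eq (@lift_inj _ _)) => /fsep.
  - by have [t tn et] := far i'; exists t => //; rewrite metric_sym.
have [c cP] := choice (fun ij : 'I_p * 'I_k =>
  near_f _ (trajectory_subsample k ij.2 (gF ij.1))).
suff cinj : injective (fun i : 'I_p => [ffun j : 'I_k => c (i, j)]).
  by have := leq_card _ cinj; rewrite card_ffun !card_ord.
move=> i i' /ffunP cii'; apply/eqP/negPn/negP => /gsep[t tn].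
apply/negP; rewrite -ltNge.
have tq : (t %/ k < n)%N by rewrite ltn_divLR.
pose r := Ordinal (ltn_pmod t k0).
have := cii' r; rewrite !ffunE => cr.
have := cP (i, r) _ tq; have := cP (i', r) _ tq.
rewrite /= -divn_eq -cr => i't it.
apply: le_lt_trans (metric_triangle _ (f (c (i, r)) (t %/ k)%N) _) _.
by rewrite mulr2n ltrD// metric_sym.
Qed.

(** * Growth rates *)

Lemma le_lne {R : realType} {x y : \bar R} : (x <= y)%E -> (lne x <= lne y)%E.
Proof.
move=> xy; have [x0|x0] := leP x 0%E; first by rewrite (le0_lneNy x0) leNye.
by rewrite lee_lne// in_itv/= leey andbT ?(ltW x0)// (le_trans (ltW x0)).
Qed.

(** Unlike an approximation by [b + e] with [0 < e], this test also applies when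
    [b] is [-oo], the growth rate of a sequence of zeros. *)
Lemma lee_of_real_gt {R : realType} {a b : \bar R} :
  (forall c : R, (b < c%:E)%E -> (a <= c%:E)%E) -> (a <= b)%E.
Proof.
case: b => [b||] H; last 2 first.
- exact: leey.
- case: a H => [a||] H //.
    by have := H (a - 1)%R (ltNyr _); rewrite lee_fin => ?; exfalso; lra.
  by have := H 0 (ltNyr _).
by apply/lee_addgt0Pr => e e0; rewrite -EFinD H// lte_fin ltrDl.
Qed.

Lemma limn_esup_lt_near {R : realType} {u : nat -> \bar R} {c : \bar R} :
  (limn_esup u < c)%E -> \forall n \near \oo, (u n <= c)%E.
Proof.
move=> /ereal_inf_lt[_ [V Voo <-] Vc]; apply: filterS Voo => n Vn.
by apply: le_trans (ltW Vc); apply: ereal_sup_ubound; exists n.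
Qed.

Lemma limn_esup_le_near {R : realType} {u : nat -> \bar R} {c : \bar R} :
  (\forall n \near \oo, (u n <= c)%E) -> (limn_esup u <= c)%E.
Proof.
move=> uc; apply: (@le_trans _ _ (ereal_sup (u @` [set n | (u n <= c)%E]))).
  by apply: ereal_inf_lbound; exists [set n | (u n <= c)%E].
by apply: ge_ereal_sup => _ [n nc <-].
Qed.

Definition growth_rate {R : realType} (s : nat -> \bar R) : \bar R :=
  limn_esup (fun n => ((n%:R)^-1)%:E * lne (s n))%E.

Lemma le_growth_rate {R : realType} {s s' : nat -> \bar R} :
  (forall n, (s n <= s' n)%E) -> (growth_rate s <= growth_rate s')%E.
Proof.
move=> ss'; apply: lee_of_real_gt => c /limn_esup_lt_near s'c.
apply: limn_esup_le_near; apply: filterS s'c => n; apply: le_trans.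
by apply: lee_wpmul2l; rewrite ?lee_fin ?invr_ge0//; exact: le_lne.
Qed.

(** Sampling a sequence along the multiples of [k] multiplies its exponential
    growth rate by at most [k], since the upper limit over a subsequence does
    not exceed the whole one. *)
Lemma growth_rate_subsample {R : realType} {s s' : nat -> \bar R} {k : nat} :
  (0 < k)%N -> (forall n, (0 < n)%N -> (s n <= s' (n * k)%N)%E) ->
  (growth_rate s <= (k%:R)%:E * growth_rate s')%E.
Proof.
move=> k0 ss'; have k0R : 0 < k%:R :> R by rewrite ltr0n.
apply: lee_of_real_gt => c; rewrite -(lte_pdivlMl _ _ k0R) -EFinM.
move=> /limn_esup_lt_near[N _ Nc]; apply: limn_esup_le_near.
exists N.+1 => // n /= Nn; have n0 : (0 < n)%N by exact: leq_ltn_trans Nn.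
have n0R : 0 < n%:R :> R by rewrite ltr0n.
rewrite lee_pdivrMl// -EFinM; apply: le_trans (le_lne (ss' n n0)) _.
have := Nc (n * k)%N (leq_trans (ltnW Nn) (leq_pmulr n k0)).
rewrite lee_pdivrMl ?ltr0n ?muln_gt0 ?n0// -EFinM natrM.
by rewrite -mulrA mulVKf// gt_eqF.
Qed.

(** Conversely, the values of [s] along the multiples of [k] control all others
    when [s] is nondecreasing: rounding the index up to a multiple of [k]
    changes it by at most [k], which is negligible in the limit. *)
Lemma growth_rate_multiples {R : realType} {s s' : nat -> \bar R} {k : nat} :
  (0 < k)%N ->
  (forall m n, (0 < m)%N -> (m <= n)%N -> (s m <= s n)%E) ->
  (forall n, (0 < n)%N -> (lne (s (n * k)%N) <= (k%:R)%:E * lne (s' n))%E) ->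
  (growth_rate s <= growth_rate s')%E.
Proof.
move=> k0 smono ss'; have k0R : 0 < k%:R :> R by rewrite ltr0n.
apply: lee_of_real_gt => c /limn_esup_lt_near[N _ Nc].
apply/lee_addgt0Pr => d d0; rewrite -EFinD.
apply: limn_esup_le_near.
(* The rounding error costs at most [k * |c|], which [m * d] absorbs as soon as
   [m] is at least [k * |c| / d]. The absolute value matters: [c] may be negative
   when [s'] vanishes. *)
have q0 : 0 <= k%:R * `|c| / d by rewrite divr_ge0 ?mulr_ge0// ltW.
exists (maxn (N * k) (Num.bound (k%:R * `|c| / d))).+1 => // m /= mlb.
have m0 : (0 < m)%N by exact: leq_ltn_trans mlb.
have m0R : 0 < m%:R :> R by rewrite ltr0n.
move: mlb; rewrite gtn_max => /andP[Nm dm].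
have cd : k%:R * `|c| <= m%:R * d.
  rewrite -ler_pdivrMr//; apply: le_trans (ltW (archi_boundP q0)) _.
  by rewrite ler_nat ltnW.
(* The least multiple of [k] exceeding [m] replaces the ceiling of [m / k]. *)
pose n := (m %/ k).+1.
have mn : (m <= n * k)%N by rewrite ltnW// -ltn_divLR.
have nm : (n * k <= m + k)%N by rewrite mulSn addnC leq_add2r leq_trunc_div.
have n0R : 0 < n%:R :> R by rewrite ltr0n.
rewrite lee_pdivrMl// -EFinM.
apply: le_trans (le_lne (smono _ _ m0 mn)) _.
apply: le_trans (ss' n isT) _.
have Nn : (N <= n)%N by rewrite leqW// leq_divRL// ltnW.
have := Nc n Nn; rewrite lee_pdivrMl// -EFinM => sc.
apply: (@le_trans _ _ ((k%:R)%:E * (n%:R * c)%:E)%E).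
  by apply: lee_wpmul2l => //; rewrite lee_fin ltW.
rewrite -EFinM lee_fin.
move: mn nm; rewrite -!(ler_nat R) natrM natrD => mn nm.
have : (n%:R * k%:R - m%:R) * c <= k%:R * `|c|.
  apply: (@le_trans _ _ ((n%:R * k%:R - m%:R) * `|c|)).
    by apply: ler_wpM2l; [rewrite subr_ge0|exact: ler_norm].
  by apply: ler_wpM2r => //; rewrite lerBlDl.
move: cd; set a := `|c|; lra.
Qed.

(** * Separation numbers of a map and of its iterates *)

Lemma le_sep_number_scale {R : realType} {X : metricType R} {F : X -> set X}
    (n : nat) {e e' : R} :
  e <= e' -> (sep_number F n e' <= sep_number F n e)%E.
Proof.
move=> ee'; apply: ereal_sup_le => _ [m [A [AF Asep Am]] <-].
exists m => //; exists A; split=> // x y Ax Ay xy.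
exact: le_trans (Asep _ _ Ax Ay xy).
Qed.

Lemma le_sep_number_length {R : realType} {X : metricType R} {F : X -> set X}
    {n n' : nat} {e : R} :
  nonempty_valued F -> 0 < e -> (0 < n)%N -> (n <= n')%N ->
  (sep_number F n e <= sep_number F n' e)%E.
Proof.
move=> F0 e0 n0 nn'; rewrite !sep_number_families// ?(leq_trans n0)//.
apply: ereal_sup_le => _ [m Fm <-]; exists m => //.
exact: separated_family_mono Fm.
Qed.

Lemma sep_number_iter_le {R : realType} {X : metricType R} {F : X -> set X}
    {k n : nat} {e : R} :
  nonempty_valued F -> (0 < k)%N -> 0 < e -> (0 < n)%N ->
  (sep_number (set_iter k F) n e <= sep_number F (n * k) e)%E.
Proof.
move=> F0 k0 e0 n0; rewrite !sep_number_families ?muln_gt0 ?n0//; last first.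
  exact: set_iter_nonempty.
apply: ereal_sup_le => _ [m Fm <-]; exists m => //.
exact: separated_family_refine.
Qed.

(** The power bound on families becomes a linear one after taking logarithms.
    If [sep_number (set_iter k F) n e] is infinite there is nothing to prove;
    otherwise it bounds the sizes of the families it counts, so that one of
    maximal size exists. *)
Lemma lne_sep_number_le_iter {R : realType} {X : metricType R} {F : X -> set X}
    {k n : nat} {e : R} :
  nonempty_valued F -> (0 < k)%N -> 0 < e -> (0 < n)%N ->
  (lne (sep_number F (n * k) (e *+ 2)) <=
   (k%:R)%:E * lne (sep_number (set_iter k F) n e))%E.
Proof.
move=> F0 k0 e0 n0; have k0R : 0 < k%:R :> R by rewrite ltr0n.
have Fk0 : nonempty_valued (set_iter k F) by exact: set_iter_nonempty.
have e20 : 0 < e *+ 2 by rewrite mulrn_wgt0.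
have nk0 : (0 < n * k)%N by rewrite muln_gt0 n0.
set S := separated_family (set_iter k F) n e.
set s := sep_number (set_iter k F) n e.
have sub m : S m -> (m%:R%:E <= s)%E.
  by move=> Sm; rewrite /s sep_number_families//; apply: ereal_sup_ubound; exists m.
have [->|sfin] := eqVneq s +oo%E; first by rewrite /= gt0_muley ?lte_fin ?leey.
have S0 : S 0%N.
  have f0 : 'I_0 -> nat -> X by case.
  by exists f0; split=> -[].
have [M SM] : exists M, forall m, `[<S m>] -> (m <= M)%N.
  have sr : s \is a fin_num.
    rewrite fin_numElt ltey sfin andbT.
    by apply: lt_le_trans (ltNyr 0) _; exact: sub S0.
  exists (Num.bound (fine s)) => m /asboolP/sub.
  rewrite -{1}(fineK sr) lee_fin -(ler_nat R) => ms.
  have s0 : 0 <= fine s by apply: le_trans ms.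
  exact: le_trans ms (ltW (archi_boundP s0)).
have exS : exists m, `[<S m>] by exists 0%N; apply/asboolP.
have [m /asboolP Sm mmax] := ex_maxnP exS SM.
have Sm1 : ~ S m.+1 by move=> /asboolP/mmax; rewrite ltnn.
apply: (@le_trans _ _ ((k%:R)%:E * lne (m%:R)%:E)%E); last first.
  by apply: lee_wpmul2l; [rewrite lee_fin|exact: le_lne (sub _ Sm)].
apply: (@le_trans _ _ (lne ((m ^ k)%:R)%:E)).
  apply: le_lne; rewrite sep_number_families//; apply: ge_ereal_sup => _ [p Fp <-].
  by rewrite lee_fin ler_nat; exact: separated_family_power Sm Sm1 Fp.
have [m0|m0] := posnP m.
  by rewrite m0 exp0n// [X in (X <= _)%E]le0_lneNy ?leNye.
rewrite !lne_EFin ?ltr0n ?expn_gt0 ?m0// natrX lnXn ?ltr0n//.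
by rewrite -EFinM mulr_natl.
Qed.

(** Shrinking [e] increases the growth rate, so the limit at [0] is a supremum
    and the two inequalities can be proved one scale at a time. *)
Lemma entropyE {R : realType} {X : metricType R} {F : X -> set X} :
  entropy F = ereal_sup [set growth_rate (fun n => sep_number F n e)
                        | e in [set e : R | 0 < e]].
Proof.
rewrite /entropy; apply/cvg_lim => //.
have := @nonincreasing_at_right_cvge R
  (fun e => growth_rate (fun n => sep_number F n e)) 0 +oo%O.
have -> : [set` `]0, +oo[] = [set e : R | 0 < e].
  by apply/seteqP; split=> e /=; rewrite in_itv/= andbT.
apply=> // e e' _ _ ee'; apply: le_growth_rate => n.
exact: le_sep_number_scale.
Qed.

Theorem theorem5p4 (R : realType) (X : metricType R)
    (hX : compact [set: X]) (F : X -> set X)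
    (hF : compact_valued F) (hFusc : upper_semicontinuous F)
    (k : nat) (hk : (0 < k)%N) :
  (entropy F <= entropy (set_iter k F))%E /\
  (entropy (set_iter k F) <= (k%:R)%:E * entropy F)%E.
Proof.
have F0 : nonempty_valued F by move=> x; have [] := hF x.
rewrite !entropyE; split; apply: ge_ereal_sup => _ [e /= e0 <-].
- have e20 : 0 < e / 2 by rewrite divr_gt0.
  apply: (@le_trans _ _
    (growth_rate (fun n => sep_number (set_iter k F) n (e / 2)))); last first.
    by apply: ereal_sup_ubound; exists (e / 2).
  apply: (growth_rate_multiples hk) => [m n m0 mn|n n0].
    exact: le_sep_number_length.
  have {1}-> : e = (e / 2) *+ 2 by rewrite -mulr_natr divfK.
  exact: lne_sep_number_le_iter.
- apply: (@le_trans _ _ ((k%:R)%:E * growth_rate (fun n => sep_number F n e))%E).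
    by apply: (growth_rate_subsample hk) => n n0; exact: sep_number_iter_le.
  apply: lee_wpmul2l; first by rewrite lee_fin.
  by apply: ereal_sup_ubound; exists e.
Qed.
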